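(* Let $\eta\in\Omega=\{0,1\}^{\mathbb N}$. For any $k,\ell\in\mathbb N$, $\sigma\in\{\uparrow,\downarrow\}$ and $x\in\mathbb N$, $$\Psi_k(\eta)^{\sigma}_{\ell}(x)=\eta^{\sigma}_{k+\ell}\big(s_k(\eta,x)\big).$$ In particular, $r(\Psi_k(\eta),x)=r(\eta,s_k(\eta,x))$.
   Context: $\mathbb N=\{1,2,\dots\}$ and $\Omega=\{0,1\}^{\mathbb N}$. Carrier with seat numbers: for $\eta\in\Omega$ and $k\in\mathbb N$, $\mathcal W_k(\eta,\cdot):\mathbb Z_{\ge0}\to\{0,1\}$ is defined by $\mathcal W_k(\eta,0)=0$ and, for $x\ge1$, $$\mathcal W_k(\eta,x)=\mathcal W_k(\eta,x-1)+\eta^{\uparrow}_k(x)-\eta^{\downarrow}_k(x),$$ where the seat number configuration $\eta^\sigma_k\in\Omega$, $\sigma\in\{\uparrow,\downarrow\}$, is $$\eta^{\uparrow}_k(x)=\eta(x)(1-\mathcal W_k(\eta,x-1))\prod_{j=1}^{k-1}\mathcal W_j(\eta,x-1),\qquad \eta^{\downarrow}_k(x)=(1-\eta(x))\mathcal W_k(\eta,x-1)\prod_{j=1}^{k-1}(1-\mathcal W_j(\eta,x-1)).$$ Let $r(\eta,x)=1-\sum_{k\in\mathbb N}(\eta^\uparrow_k(x)+\eta^\downarrow_k(x))\in\{0,1\}$. For $k\in\mathbb N$ let $\xi_k(\eta,0)=0$, $\xi_k(\eta,x)=x-\sum_{y=1}^{x}\sum_{j=1}^{k}(\eta^\uparrow_j(y)+\eta^\downarrow_j(y))$,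 and $s_k(\eta,i)=\min\{x\in\mathbb Z_{\ge0}:\xi_k(\eta,x)=i\}$ for $i\in\mathbb Z_{\ge0}$, where $\min\emptyset:=\infty$. The $k$-skip map $\Psi_k:\Omega\to\Omega$ is $\Psi_k(\eta)(x)=\eta(s_k(\eta,x))$. The seat number configuration $\Psi_k(\eta)^\sigma_\ell$ is that of the configuration $\Psi_k(\eta)$.
   Formalization: The identities are stated for those x with s_k(η,x) finite; when s_k(η,x)=∞ the values η(∞) and η^σ_{k+l}(∞) are undefined and no fixed convention makes the identity true, so Ψ_k uses an arbitrary value for η(∞). *)

(* Defs.v *)
From HB Require Import structures.
From mathcomp Require Import all_boot all_order all_algebra.
From mathcomp Require Import boolp classical_sets functions cardinality fsbigop.

Set Implicit Arguments.
Unset Strict Implicit.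
Unset Printing Implicit Defensive.

Import Order.TTheory GRing.Theory Num.Theory.

Local Open Scope classical_set_scope.
Local Open Scope ring_scope.

(* An element of {0,1}^N with N = {1, 2, ...}. The entry at 0 is a
   dummy: at x >= 1, no definition below depends on it. *)
Definition config := nat -> bool.

Inductive arrow := Up | Down.

(* The formula for eta^sigma_k(x), as a function of b = eta(x) and of the
   carrier w = (j |-> W_j(eta, x - 1)); it is isolated because the carrier and
   the seat numbers are defined by mutual recursion on x. *)
Definition seat_rule (b : bool) (w : nat -> int) (sigma : arrow) (k : nat)
    : int :=
  match sigma with
  | Up => b%:Z * (1 - w k) * \prod_(1 <= j < k) w j
  | Down => (1 - b%:Z) * w k * \prod_(1 <= j < k) (1 - w j)
  end.

Fixpoint carrier (eta : config) (k x : nat) {struct x} : int :=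
  match x with
  | 0%N => 0
  | y.+1 => let w j := carrier eta j y in
            carrier eta k y + seat_rule (eta y.+1) w Up k
                            - seat_rule (eta y.+1) w Down k
  end.

Definition seat (eta : config) (sigma : arrow) (k x : nat) : int :=
  seat_rule (eta x) (fun j => carrier eta j x.-1) sigma k.

Lemma carrierS (eta : config) (k x : nat) :
  carrier eta k x.+1 = carrier eta k x + seat eta Up k x.+1
                                       - seat eta Down k x.+1.
Proof. by []. Qed.

Lemma seat_rule_eq0 (b : bool) (w : nat -> int) (sigma : arrow) (n k : nat) :
  (forall j, (n < j)%N -> w j = 0) -> (n.+1 < k)%N -> seat_rule b w sigma k = 0.
Proof.
move=> w0 nk; case: sigma => /=; last by rewrite (w0 k (ltnW nk)) mulr0 mul0r.
rewrite (bigD1_seq n.+1) ?iota_uniq //=; last by rewrite mem_index_iota.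
by rewrite (w0 n.+1) // mul0r mulr0.
Qed.

Lemma carrier_eq0 (eta : config) (k x : nat) :
  (x < k)%N -> carrier eta k x = 0.
Proof.
elim: x k => [//|x IH] k xk.
rewrite carrierS (IH k (ltnW xk)) /seat.
by rewrite !(@seat_rule_eq0 _ _ _ x) // subrr.
Qed.

Lemma finite_seat (eta : config) (x : nat) :
  finite_set ([set k : nat | (0 < k)%N] `&`
              (fun k => seat eta Up k x + seat eta Down k x) @^-1` [set~ 0]).
Proof.
apply: (@sub_finite_set _ _ `I_x.-1.+2); last exact: finite_II.
move=> k [_ /= nz]; rewrite ltnNge; apply/negP => xk; apply: nz.
have w0 j : (x.-1 < j)%N -> carrier eta j x.-1 = 0 by exact: carrier_eq0.
have seat0 sigma : seat eta sigma k x = 0 by exact: seat_rule_eq0 w0 xk.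
by rewrite -[LHS]/(seat eta Up k x + seat eta Down k x) !seat0.
Qed.

(* The sum over k ranges over all k >= 1; \sum_(_ \in _) is the sum of a
   finitely supported family, see finite_seat. *)
Definition r (eta : config) (x : nat) : int :=
  1 - \sum_(k \in [set k : nat | (0 < k)%N]) (seat eta Up k x + seat eta Down k x).

Definition xi (eta : config) (k x : nat) : int :=
  x%:Z - \sum_(1 <= y < x.+1) \sum_(1 <= j < k.+1)
           (seat eta Up j y + seat eta Down j y).

(* Values in Z_{>=0} U {oo}, with None for oo = min of the empty set. *)
Definition s (eta : config) (k i : nat) : option nat :=
  match pselect (exists x : nat, xi eta k x == i%:Z) with
  | left ex => Some (ex_minn ex)
  | right _ => None
  end.

(* s_k(eta, x) may be oo (for instance k = 1 and eta = 101010...), so Psi_k is a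
   map on configurations only once eta(oo) has been given a value, einf. *)
Definition Psi (einf : bool) (k : nat) (eta : config) : config :=
  fun x => match s eta k x with Some y => eta y | None => einf end.

(* Main.v *)
(* Let pass be 1 when the seats 1..k are all occupied and a passenger arrives, or
   all empty and one departs, and 0 otherwise. Telescoping shows that the first
   k seats change exactly when pass = 0, so pass is the increment of xi_k, and
   the rule for seat k + l is pass times the rule for seat l of the carrier
   shifted by k. Hence the seats above k move only at the sites s_k(eta, .),
   where they follow the rule of Psi_k(eta), and
   W_{k+l}(eta, y) = W_l(Psi_k(eta), xi_k(eta, y)). *)
Require Import Defs.
From mathcomp Require Import all_boot all_order all_algebra.
From mathcomp Require Import boolp classical_sets fsbigop ring.

Set Implicit Arguments.
Unset Strict Implicit.
Unset Printing Implicit Defensive.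

Import Order.TTheory GRing.Theory Num.Theory.

Local Open Scope ring_scope.

Definition pass (b : bool) (w : nat -> int) (k : nat) : int :=
  \prod_(1 <= j < k.+1) (if b then w j else 1 - w j).

(** For either value of [b] only one of the two rules survives, and its value at seat [j] is the
    difference of [pass] at [j - 1] and at [j]; the sum telescopes. *)
Lemma sum_seat_rule b w k :
  \sum_(1 <= j < k.+1) (seat_rule b w Up j + seat_rule b w Down j)
  = 1 - pass b w k.
Proof.
rewrite /pass; elim: k => [|k IH]; first by rewrite !big_nil subrr.
rewrite big_nat_recr //= IH [in RHS]big_nat_recr //=.
by case: b {IH} => /=; ring.
Qed.

Lemma prod_addl (F : nat -> int) k l : (0 < l)%N ->
  \prod_(1 <= j < k + l) F j =
  (\prod_(1 <= j < k.+1) F j) * \prod_(1 <= j < l) F (k + j)%N.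
Proof.
move=> l0; rewrite (@big_cat_nat _ _ _ k.+1) //=; last first.
  by rewrite -addn1 leq_add2l.
congr (_ * _); rewrite -add1n [(k + l)%N]addnC big_addn addnK.
by apply: eq_bigr => j _; rewrite addnC.
Qed.

Lemma pass_addl b w k l :
  pass b w (k + l) = pass b w k * pass b (fun j => w (k + j)%N) l.
Proof. by rewrite /pass -addnS prod_addl. Qed.

Lemma seat_rule_addl b w sigma k l : (0 < l)%N ->
  seat_rule b w sigma (k + l) =
  pass b w k * seat_rule b (fun j => w (k + j)%N) sigma l.
Proof.
move=> l0; rewrite /pass; case: sigma; rewrite /= prod_addl //.
  by case: b => /=; ring.
by case: b => /=; ring.
Qed.

(** Index 0 is left out because a carrier shifted by [k] has seat [k] of [eta] there, which need not
    match the dummy seat 0 of [Psi]. *)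
Lemma eq_pass b w w' k :
  (forall j, (0 < j)%N -> w j = w' j) -> pass b w k = pass b w' k.
Proof. by move=> ww'; apply: eq_big_nat => j /andP[j0 _]; rewrite ww'. Qed.

Lemma eq_seat_rule b w w' sigma l : (0 < l)%N ->
  (forall j, (0 < j)%N -> w j = w' j) ->
  seat_rule b w sigma l = seat_rule b w' sigma l.
Proof.
move=> l0 ww'; case: sigma => /=; rewrite ww' //; congr (_ * _);
  by apply: eq_big_nat => j /andP[j0 _]; rewrite ww'.
Qed.

Definition is01 (z : int) := (z == 0) || (z == 1).

Lemma is01_prod (I : Type) (t : seq I) (F : I -> int) :
  (forall i, is01 (F i)) -> is01 (\prod_(i <- t) F i).
Proof.
move=> F01; apply: (big_ind is01) => //.
by move=> a b /orP[]/eqP-> /orP[]/eqP->.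
Qed.

Lemma is01_compl z : is01 z -> is01 (1 - z).
Proof. by case/orP=> /eqP->. Qed.

Lemma is01_carrier eta k x : is01 (carrier eta k x).
Proof.
elim: x k => [//|x IH] k; rewrite carrierS /seat /=.
have P1 : is01 (\prod_(1 <= j < k) carrier eta j x) by exact: is01_prod.
have P0 : is01 (\prod_(1 <= j < k) (1 - carrier eta j x)).
  by apply: is01_prod => j; exact: is01_compl.
(* Up can add 1 only to an empty seat, and Down can remove 1 only from an occupied one. *)
by case: (eta x.+1); case/orP: (IH k) => /eqP->;
  case/orP: P1 => /eqP->; case/orP: P0 => /eqP->.
Qed.

Lemma is01_pass b eta k x : is01 (pass b (fun j => carrier eta j x) k).
Proof.
apply: is01_prod => j; case: b; first exact: is01_carrier.
exact/is01_compl/is01_carrier.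
Qed.

Lemma xi0 eta k : xi eta k 0 = 0.
Proof. by rewrite /xi big_nil subrr. Qed.

Lemma xiS eta k x :
  xi eta k x.+1 = xi eta k x + pass (eta x.+1) (fun j => carrier eta j x) k.
Proof.
rewrite /xi big_nat_recr //= /seat /= (sum_seat_rule (eta x.+1)).
by rewrite -addn1 PoszD; ring.
Qed.

Lemma xi_nondecreasing eta k : {homo xi eta k : x y / (x <= y)%N >-> x <= y}.
Proof.
apply: homo_leq => [x|y x z|x]; [exact: lexx|exact: le_trans|].
by rewrite xiS lerDl; case/orP: (is01_pass (eta x.+1) eta k x) => /eqP->.
Qed.

(** Since [xi] starts at 0 and grows by steps of 0 or 1, a level [x.+1] is first reached by a unit
    step from [x]. This trades the minimum for a local condition. *)
Lemma s_someP eta k x y : s eta k x.+1 = Some y <->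
  exists2 z, y = z.+1 & xi eta k z = x%:Z
    /\ pass (eta z.+1) (fun j => carrier eta j z) k = 1.
Proof.
rewrite /s; split.
  case: pselect => [ex [<-]|//]; case: ex_minnP => -[|z] /eqP xiz zmin.
    by move: xiz; rewrite xi0.
  exists z => //; have := xiS eta k z; rewrite xiz.
  case/orP: (is01_pass (eta z.+1) eta k z) => /eqP ->; last first.
    by rewrite -addn1 PoszD => /addIr <-.
  (* With a zero step the level would already be reached at [z], against minimality. *)
  by rewrite addr0 => /esym/eqP/zmin; rewrite ltnn.
move=> [z -> [xiz p1]].
have xiSz : xi eta k z.+1 = x.+1%:Z by rewrite xiS xiz p1 -PoszD addn1.
case: pselect => [ex|[]]; last by exists z.+1; apply/eqP.
case: ex_minnP => m /eqP xim mmin; congr Some; apply/eqP.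
rewrite eqn_leq mmin ?xiSz //= ltnNge; apply/negP => /(xi_nondecreasing eta k).
by rewrite xim xiz lez_nat ltnn.
Qed.

Lemma carrier_Psi einf eta k y : exists2 n, xi eta k y = n%:Z &
  forall l, (0 < l)%N ->
    carrier (Psi einf k eta) l n = carrier eta (k + l) y.
Proof.
elim: y => [|y [n xin IH]]; first by exists 0%N; rewrite ?xi0.
case/orP: (is01_pass (eta y.+1) eta k y) => /eqP p.
  exists n; first by rewrite xiS p addr0.
  move=> l l0; rewrite carrierS /seat !seat_rule_addl //= p !mul0r.
  by rewrite subr0 addr0 IH.
exists n.+1; first by rewrite xiS p xin -PoszD addn1.
(* A unit step makes [y.+1] the next retained site, so [Psi] at [n.+1] reads [eta y.+1]. *)
have sn : s eta k n.+1 = Some y.+1 by apply/s_someP; exists y.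
move=> l l0; rewrite !carrierS IH // /seat !seat_rule_addl // p !mul1r.
by rewrite {1 3}/Psi sn; congr (_ + _ - _); exact: eq_seat_rule.
Qed.

Lemma seat_Psi einf eta k l sigma x y : (0 < l)%N -> (0 < x)%N ->
  s eta k x = Some y ->
  seat (Psi einf k eta) sigma l x = seat eta sigma (k + l) y.
Proof.
case: x => // x l0 _ sx; have /s_someP[z yz [xiz p]] := sx; subst y.
(* Here [n] is identified with [x], so [cP] compares the carriers just before the sites [x.+1] and
   [z.+1]. *)
have [n] := carrier_Psi einf eta k z; rewrite xiz => -[<-] cP.
by rewrite /seat seat_rule_addl //= p mul1r {1}/Psi sx; exact: eq_seat_rule.
Qed.

(** At site [x.+1] no seat beyond [x.+1] can change, so the infinite sum may be cut at any [N.+1]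
    and telescoped. The freedom in [N] lets two cuts differ by exactly [k]. *)
Lemma r_pass eta x N : (x <= N)%N ->
  r eta x.+1 = pass (eta x.+1) (fun j => carrier eta j x) N.+1.
Proof.
move=> xN; rewrite /r (fsbigE (index_iota 1 N.+2)) ?iota_uniq //; first last.
- move=> i /= i0; rewrite mem_index_iota i0 /= ltnNge negbK => Ni.
  have w0 j : (x < j)%N -> carrier eta j x = 0 by exact: carrier_eq0.
  have seat0 sigma : seat eta sigma i x.+1 = 0.
    by apply: seat_rule_eq0 w0 _; exact: leq_ltn_trans Ni.
  by rewrite -[LHS]/(seat eta Up i x.+1 + seat eta Down i x.+1) !seat0.
- by move=> i /=; rewrite mem_index_iota => /andP[].
rewrite big_seq_cond (eq_bigl (fun i => i \in index_iota 1 N.+2)); last first.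
  move=> i; rewrite mem_index_iota; case: ltnP => //= i0.
  by rewrite (mem_set (i0 : [set k : nat | (0 < k)%N]%classic i)) andbT.
by rewrite -big_seq /seat /= (sum_seat_rule (eta x.+1)) opprB addrC subrK.
Qed.

Theorem proposition2p8 (eta : config) (einf : bool) (k : nat) (hk : (0 < k)%N) :
  (forall (l : nat) (sigma : arrow) (x y : nat),
      (0 < l)%N -> (0 < x)%N -> s eta k x = Some y ->
      seat (Psi einf k eta) sigma l x = seat eta sigma (k + l)%N y)
  /\
  (forall x y : nat,
      (0 < x)%N -> s eta k x = Some y ->
      r (Psi einf k eta) x = r eta y).
Proof.
split=> [l sigma x y l0 x0 sx|]; first exact: seat_Psi.
case=> // x y _ sx; have /s_someP[z yz [xiz p]] := sx; subst y.
have [n] := carrier_Psi einf eta k z; rewrite xiz => -[<-] cP.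
(* Both products of pass run over more seats than can be occupied. *)
rewrite (r_pass _ (leq_addr z x)) (@r_pass _ _ (k + (x + z))); last first.
  by rewrite addnA leq_addl.
by rewrite -(addnS k) pass_addl p mul1r {1}/Psi sx; exact: eq_pass.
Qed.
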